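(* Let $f=1+2x_1+2^2x_2+\dots+2^nx_n$ (a linear polynomial over $\mathbb{Q}$, the coefficient of $x_i$ being $2^i$). Then every $\mathrm{Res}(\mathrm{lin}_{\mathbb{Q}})$ refutation of the single linear clause $f=0$ has size $2^{\Omega(n)}$.
   Context: A linear form (linear polynomial) over a ring $R$ is an expression $\sum_i a_ix_i+b$ with $a_i,b\in R$. A linear clause over $R$ is a disjunction $(f_1=0)\vee\dots\vee(f_k=0)$ of linear equations (duplicate disjuncts identified); the empty clause stands for false. Variables range over $\{0,1\}$. The proof system $\mathrm{Res}(\mathrm{lin}_R)$ has the boolean axioms $x=0\vee x=1$ for every variable $x$ and the rules: resolution (from $C\vee f=0$ and $D\vee g=0$ derive $C\vee D\vee(\alpha f+\beta g=0)$ for any $\alpha,\beta\in R$), simplification (from $C\vee a=0$ with $a\in R\setminus\{0\}$ a constant derive $C$), and weakening (from $C$ derive $C\vee f=0$ for any linear form $f$). A derivation of $D$ from a set $\phi$ of linear clauses is a sequence of linear clauses ending in $D$, each of which is in $\phi$, a boolean axiom, or obtained from earlier clauses by a rule; a refutation of $\phi$ is a derivation of the empty clause from $\phi$. The size of a derivation is the total number of occurrences of variables in its clauses plus the total bit-size of all coefficients occurring in it. *)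

(* Defs.v *)
From HB Require Import structures.
From mathcomp Require Import all_boot all_order all_algebra finmap.
From mathcomp Require Import monalg.
From mathcomp Require Import mathcomp_extra boolp classical_sets reals exp.

Set Implicit Arguments.
Unset Strict Implicit.
Unset Printing Implicit Defensive.

Import Order.TTheory GRing.Theory Num.Theory.

Local Open Scope fset_scope.
Local Open Scope ring_scope.

(* The pair (g, b) is the linear form \sum_i g_i x_i + b, where g : {malg R[nat]}
   is finitely supported; [msupp g] is the set of variables occurring in it.
   [R^o] makes the product a left R-module, so that linear combinations of
   linear forms are those of the library. *)
Definition linform (R : nzRingType) : Type := ({malg R[nat]} * R^o)%type.

Definition lvar (R : nzRingType) (i : nat) : linform R := (<< i >>, 0).

Definition lconst (R : nzRingType) (b : R) : linform R := (0, b).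

(* The finite set [fset f1; ...; fk] stands for the disjunction
   (f1 = 0) \/ ... \/ (fk = 0), and [fset0] for false. *)
Definition clause (R : nzRingType) : Type := {fset linform R}.

(* [inference phi s D]: D belongs to phi, is a boolean axiom, or follows by one
   application of a rule from clauses of s.  The clause "C or f = 0" is
   [f |` C], where f is allowed to be in C already. *)
Inductive inference (R : nzRingType) (phi : set (clause R))
    (s : seq (clause R)) : clause R -> Prop :=
| Hypothesis_clause (C : clause R) :
    phi C -> inference phi s C
| Boolean_axiom (i : nat) :
    inference phi s [fset lvar R i; lvar R i - lconst 1]
| Resolution (C D : clause R) (f g : linform R) (a b : R) :
    f |` C \in s -> g |` D \in s ->
    inference phi s ((a *: f + b *: g) |` (C `|` D))
| Simplification (C : clause R) (a : R) :
    a != 0 -> lconst a |` C \in s -> inference phi s C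
| Weakening (C : clause R) (f : linform R) :
    C \in s -> inference phi s (f |` C).

Definition derivation (R : nzRingType) (phi : set (clause R)) (D : clause R)
    (p : seq (clause R)) : Prop :=
  (exists s, p = rcons s D) /\
  (forall i, (i < size p)%N -> inference phi (take i p) (nth fset0 p i)).

Definition refutation (R : nzRingType) (phi : set (clause R))
    (p : seq (clause R)) : Prop :=
  derivation phi fset0 p.

(* Number of binary digits, with one digit for 0. *)
Definition nat_bits (m : nat) : nat := (trunc_log 2 m).+1.

Definition rat_bits (q : rat) : nat :=
  (nat_bits `|numq q| + nat_bits `|denq q|)%N.

Definition var_occurrences (f : linform rat) : nat := #|` msupp f.1|.

(* The coefficients of a form are those of its variables and its free term. *)
Definition coef_bits (f : linform rat) : nat :=
  (\sum_(i <- msupp f.1) rat_bits f.1@_i + rat_bits f.2)%N.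

Definition clause_size (C : clause rat) : nat :=
  (\sum_(f <- C) (var_occurrences f + coef_bits f))%N.

Definition derivation_size (p : seq (clause rat)) : nat :=
  (\sum_(C <- p) clause_size C)%N.

Definition binary_form (n : nat) : linform rat :=
  lconst 1 + \sum_(1 <= i < n.+1) (2 ^+ i : rat) *: lvar rat i.

(* Main.v *)
Require Import Defs.
From HB Require Import structures.
From mathcomp Require Import all_boot all_order all_algebra finmap.
From mathcomp Require Import monalg.
From mathcomp Require Import mathcomp_extra boolp classical_sets reals exp.
From mathcomp Require Import ring.

Set Implicit Arguments.
Unset Strict Implicit.
Unset Printing Implicit Defensive.

Import Order.TTheory GRing.Theory Num.Theory.

Local Open Scope fset_scope.
Local Open Scope ring_scope.

(** Let f be the binary form; it is injective and nonzero on the cube {0,1}^n.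
    For a linear form g, the level sets {x | g(x) = r f(x)} partition the cube,
    and two of them with distinct r have cardinals of product at most 3^n, so
    at most one level set of g, called rich, has more than 3^(n/2) points.  Say
    that x satisfies a clause if x lies in the rich level set of one of its
    forms.  Every x satisfies f = 0 (r = 1) and the boolean axioms (r = 0), and
    no x satisfies a nonzero constant, whose level sets are singletons.  If x
    satisfies both premises of a resolution step through the resolved forms but
    not the conclusion, then x lies in a fixed level set of the conclusion's
    form which is not rich: a resolution step loses at most 3^(n/2) points, and
    the other rules lose none.  Since the empty clause is satisfied nowhere,
    there are at least 2^n / 3^(n/2) resolution steps. *)

(** Parity determines the lowest digit; cancelling it and halving leaves the shifted digits. *)
Lemma binary_sum_inj (n : nat) (b c : nat -> bool) :
  (\sum_(i < n) b i * 2 ^ i = \sum_(i < n) c i * 2 ^ i)%N ->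
  forall i, (i < n)%N -> b i = c i.
Proof.
elim: n b c => [//|n IHn] b c.
have shift (d : nat -> bool) :
    (\sum_(i < n.+1) d i * 2 ^ i = d 0 + (\sum_(i < n) d i.+1 * 2 ^ i).*2)%N.
  rewrite big_ord_recl /= muln1 -mul2n big_distrr; congr addn.
  by apply: eq_bigr => i _; rewrite /= /bump /= add1n expnS mulnCA.
rewrite !shift => e.
have e0 : b 0%N = c 0%N.
  by have := congr1 odd e; rewrite !oddD !odd_double !addbF !oddb.
move: e; rewrite e0 => /addnI /double_inj e [//|i].
exact: (IHn (b \o succn) (c \o succn)).
Qed.

(** * Evaluation of linear forms on the cube *)

Section Levels.

Variable n : nat.

Local Notation cube := {ffun 'I_n -> bool}.

(* [x] assigns [x i] to the variable of index [i.+1]; the variables that do not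
   occur in [binary_form n] get the value 0. *)
Definition eval (g : linform rat) (x : cube) : rat :=
  \sum_(i < n) g.1@_i.+1 * (x i)%:R + g.2.

Lemma eval_comb (a b : rat) (f g : linform rat) (x : cube) :
  eval (a *: f + b *: g) x = a * eval f x + b * eval g x.
Proof.
rewrite /eval /= !mulrDr addrACA !mulr_sumr -big_split; congr (_ + _).
by apply: eq_bigr => i _; rewrite mcoeffD !mcoeffZ mulrDl !mulrA.
Qed.

Lemma eval_const (a : rat) (x : cube) : eval (lconst a) x = a.
Proof.
by rewrite /eval big1 ?add0r // => i _; rewrite mcoeff0 mul0r.
Qed.

Lemma eval_lvar (j : nat) (x : cube) :
  eval (lvar rat j) x = \sum_(i < n | i.+1 == j) (x i)%:R.
Proof.
rewrite /eval /= addr0 [RHS]big_mkcond; apply: eq_bigr => i _.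
by rewrite mcoeffU eq_sym; case: eqP => _; rewrite ?mul1r ?mul0r.
Qed.

Lemma eval_binary_form (x : cube) :
  eval (binary_form n) x = (1 + 2 * \sum_(i < n) x i * 2 ^ i)%N%:R.
Proof.
have coefE (i : 'I_n) : (binary_form n).1@_i.+1 = 2 ^+ i.+1.
  rewrite /binary_form /= add0r.
  rewrite (raddf_sum (fst : linform rat -> _)) /= raddf_sum /=.
  rewrite (bigD1_seq i.+1) ?mem_index_iota ?iota_uniq //=; last exact: ltn_ord.
  rewrite mcoeffZ mcoeffU eqxx mulr1 big1 ?addr0 // => j /negbTE ne.
  by rewrite mcoeffZ mcoeffU ne mulr0.
have constE : (binary_form n).2 = 1.
  rewrite /binary_form /= (raddf_sum (snd : linform rat -> _)) /= big1 ?addr0 //.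
  by move=> i _; rewrite scaler0.
rewrite /eval constE addrC natrD natrM natr_sum mulr_sumr; congr (_ + _).
by apply: eq_bigr => i _; rewrite coefE exprS natrM natrX mulrA mulrAC -mulrA.
Qed.

Lemma eval_binary_form_neq0 (x : cube) : eval (binary_form n) x != 0.
Proof. by rewrite eval_binary_form pnatr_eq0. Qed.

Lemma eval_binary_form_inj : injective (eval (binary_form n)).
Proof.
move=> x y; rewrite !eval_binary_form => /eqP; rewrite eqr_nat eqn_add2l.
rewrite eqn_pmul2l // => /eqP e.
(* Points are padded with [false] to digit sequences on [nat], as [binary_sum_inj] expects. *)
pose ext (z : cube) j := if insub j is Some i then z i else false.
have extE (z : cube) (i : 'I_n) : ext z i = z i by rewrite /ext valK.
apply/ffunP => i; rewrite -!extE; apply: binary_sum_inj (ltn_ord i).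
under eq_bigr do rewrite extE.
by under [RHS]eq_bigr do rewrite extE.
Qed.

(** * Level sets relative to the binary form *)

Definition level (g : linform rat) (r : rat) : {set cube} :=
  [set x | eval g x == r * eval (binary_form n) x].

Definition ratio (g : linform rat) (x : cube) : rat :=
  eval g x / eval (binary_form n) x.

Lemma in_level (g : linform rat) (r : rat) (x : cube) :
  (x \in level g r) = (ratio g x == r).
Proof.
have ne := eval_binary_form_neq0 x.
by rewrite inE (can2_eq (divfK ne) (mulfK ne)).
Qed.

(* For x in the first level set and y in the second, the vector x + y over
   {0,1,2} fixes both f(x) + f(y) and g(x) + g(y) = r f(x) + s f(y), hence
   f(x) and f(y), hence x and y. *)
Lemma card_levelM (g : linform rat) (r s : rat) :
  r != s -> (#|level g r| * #|level g s| <= 3 ^ n)%N.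
Proof.
move=> ne_rs; rewrite -cardsX.
(* Coordinate sums are at most 2, so [inord] loses nothing. *)
pose add (u : cube * cube) : {ffun 'I_n -> 'I_3} :=
  [ffun i => inord (u.1 i + u.2 i)].
have evalD (h : linform rat) (u v : cube * cube) : add u = add v ->
    eval h u.1 + eval h u.2 = eval h v.1 + eval h v.2.
  move=> /ffunP e; rewrite /eval !(addrACA _ h.2) -!big_split /=.
  congr (_ + _); apply: eq_bigr => i _; rewrite -!mulrDr -!natrD.
  have := congr1 val (e i); rewrite !ffunE /= !inordK => [->//||];
    by do 2 case: (_ i).
rewrite -(card_in_imset (f := add)); last first.
  move=> [x y] [x' y'] /=; rewrite !inE /=.
  move=> /andP[/eqP gx /eqP gy] /andP[/eqP gx' /eqP gy'] e.
  have /= eg := evalD g _ _ e; have /= ef := evalD (binary_form n) _ _ e.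
  rewrite gx gy gx' gy' in eg.
  have ey : eval (binary_form n) y = eval (binary_form n) y'.
    apply/eqP; rewrite -subr_eq0; move: ne_rs; rewrite -subr_eq0.
    apply: contraNT => ne; apply/eqP/(mulIf ne); rewrite mul0r.
    move: eg ef; set fx := eval _ x; set fx' := eval _ x'.
    set fy := eval _ y; set fy' := eval _ y' => eg ef.
    (* Since [r * (fx + fy) - (r * fx + s * fy)] is [(r - s) * fy], this difference depends only on
       the sums fixed by [ef] and [eg]. *)
    transitivity (r * (fx + fy) - (r * fx + s * fy)
                  - (r * (fx' + fy') - (r * fx' + s * fy'))); first by ring.
    by rewrite eg ef subrr.
  rewrite ey in ef; move/addIr: ef => /eval_binary_form_inj ->.
  by move/eval_binary_form_inj: ey => ->.
by rewrite (leq_trans (max_card _)) // card_ffun !card_ord.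
Qed.

(** * Rich level sets *)

(** Squaring keeps the threshold 3^(n/2) within the natural numbers. *)
Definition rich (g : linform rat) (x : cube) : bool :=
  (3 ^ n < #|level g (ratio g x)| ^ 2)%N.

Lemma rich_ratio (g : linform rat) (x y : cube) :
  rich g x -> rich g y -> ratio g x = ratio g y.
Proof.
move=> gx gy; apply/eqP/negPn/negP => /(card_levelM g).
apply/negP; rewrite -ltnNge -(ltn_exp2r _ _ (e := 2)) // expnMn -mulnn.
exact: ltn_mul.
Qed.

Lemma rich_binary_form (x : cube) : (0 < n)%N -> rich (binary_form n) x.
Proof.
move=> n_gt0; rewrite /rich /ratio divff ?eval_binary_form_neq0 //.
have -> : level (binary_form n) 1 = [set: cube]%SET.
  by apply/setP => y; rewrite !inE mul1r eqxx.
by rewrite cardsT card_ffun card_bool card_ord -expnM mulnC expnM ltn_exp2r.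
Qed.

(** The ratio a / f(x) determines x, because f is injective on the cube. *)
Lemma lconst_not_rich (a : rat) (x : cube) : a != 0 -> ~~ rich (lconst a) x.
Proof.
move=> a0; rewrite /rich -leqNgt (_ : level _ _ = [set x]%SET).
  by rewrite cards1 expn_gt0.
apply/setP => y; rewrite in_level inE /ratio !eval_const.
apply/eqP/eqP => [/(mulfI a0)/invr_inj/eval_binary_form_inj //|-> //].
Qed.

(** Flipping coordinate i exchanges the two halves of the cube. *)
Lemma card_coordinate (i : 'I_n) (b : bool) :
  #|[set x : cube | x i == b]| = (2 ^ n.-1)%N.
Proof.
pose flip (x : cube) : cube := [ffun j => if j == i then ~~ x j else x j].
have flipK : involutive flip.
  by move=> x; apply/ffunP => j; rewrite !ffunE; case: eqP => // _; rewrite negbK.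
have cardE : #|[set x : cube | x i == b]| = #|[set x : cube | x i != b]|.
  rewrite -(card_imset _ (inv_inj flipK)); apply: eq_card => x.
  rewrite inE -[x in LHS]flipK (mem_imset _ _ (inv_inj flipK)) inE ffunE eqxx.
  by case: (x i) b => -[].
apply: double_inj; rewrite -[in LHS]addnn [X in (_ + X)%N]cardE.
have -> : [set x : cube | x i != b] = ~: [set x : cube | x i == b].
  by apply/setP => x; rewrite !inE.
rewrite cardsC card_ffun card_bool card_ord -mul2n -expnS prednK //.
exact: leq_ltn_trans (ltn_ord i).
Qed.

(** The form that vanishes at x vanishes on at least half of the cube, and the hypothesis says that
    half of the cube exceeds the threshold. *)
Lemma rich_boolean (j : nat) (x : cube) : (3 ^ n < (2 ^ n.-1) ^ 2)%N ->
  rich (lvar rat j) x || rich (lvar rat j - lconst 1) x.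
Proof.
move=> big_n.
have rich0 (g : linform rat) : eval g x = 0 ->
    ((2 ^ n.-1) ^ 2 <= #|[set y | eval g y == 0%R]| ^ 2)%N -> rich g x.
  rewrite /rich /ratio => -> /(leq_trans big_n) lt; rewrite mul0r.
  rewrite (_ : level g 0 = [set y | eval g y == 0]) //.
  by apply/setP => y; rewrite !inE mul0r.
have evalB y : eval (lvar rat j - lconst 1) y = eval (lvar rat j) y - 1.
  have := eval_comb 1 (-1) (lvar rat j) (lconst 1) y.
  by rewrite scale1r scaleN1r eval_const mul1r mulr1.
case: (pickP [pred i : 'I_n | i.+1 == j]) => [i /= /eqP ij|none].
  have evalE y : eval (lvar rat j) y = (y i)%:R.
    rewrite eval_lvar (big_pred1 i) // => k; rewrite -ij eqSS.
    by apply/eqP/eqP => [/val_inj|->].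
  case xi: (x i); apply/orP; [right|left]; apply: rich0;
    rewrite ?evalB ?evalE ?xi ?subrr //.
  - rewrite (_ : [set _ | _] = [set y : cube | y i == true]).
      by rewrite card_coordinate.
    by apply/setP => y; rewrite !inE evalB evalE; case: (y i).
  - rewrite (_ : [set _ | _] = [set y : cube | y i == false]).
      by rewrite card_coordinate.
    by apply/setP => y; rewrite !inE evalE; case: (y i).
(* A variable absent from the binary form evaluates to 0 on the whole cube. *)
have evalE y : eval (lvar rat j) y = 0 by rewrite eval_lvar big_pred0.
apply/orP; left; apply: rich0 => //.
rewrite (_ : [set _ | _] = [set: cube]%SET); last by apply/setP => y; rewrite !inE evalE.
by rewrite cardsT card_ffun card_bool card_ord leq_exp2r // leq_exp2l // leq_pred.
Qed.

Lemma card_resolution_loss (a b : rat) (f g : linform rat) :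
  (#|[set x | [&& rich f x, rich g x & ~~ rich (a *: f + b *: g)%R x]]| ^ 2
     <= 3 ^ n)%N.
Proof.
set L := [set x | _]%SET.
have [->|[x Lx]] := set_0Vmem L; first by rewrite cards0.
move: (Lx); rewrite inE => /and3P[fx gx]; rewrite -leqNgt; apply: leq_trans.
(* Any other lost point y has the same ratios as x for f and g, hence for their combination, so it
   lies in the level set of x, which is not rich. *)
rewrite leq_exp2r //; apply/subset_leq_card/fintype.subsetP => y.
rewrite inE in_level => /and3P[fy gy _].
have ratioE z : ratio (a *: f + b *: g) z = a * ratio f z + b * ratio g z.
  by rewrite /ratio eval_comb mulrDl !mulrA.
by rewrite !ratioE (rich_ratio fx fy) (rich_ratio gx gy).
Qed.

(** * Satisfied clauses and the loss at an inference *)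

Definition satisfied (C : clause rat) (x : cube) : bool :=
  has (rich^~ x) (enum_fset C).

Lemma satisfiedP (C : clause rat) (x : cube) :
  reflect (exists2 g, g \in C & rich g x) (satisfied C x).
Proof. exact: hasP. Qed.

Lemma satisfiedU1 (f : linform rat) (C : clause rat) (x : cube) :
  satisfied (f |` C) x = rich f x || satisfied C x.
Proof.
apply/satisfiedP/orP => [[g]|[fx|/satisfiedP[g gC gx]]].
- by rewrite in_fset1U => /orP[/eqP->|gC gx]; [left|right; apply/satisfiedP; exists g].
- by exists f => //; rewrite fset1U1.
- by exists g => //; rewrite fset1Ur.
Qed.

Lemma satisfiedU (C D : clause rat) (x : cube) :
  satisfied (C `|` D) x = satisfied C x || satisfied D x.
Proof.
apply/satisfiedP/orP => [[g]|[]/satisfiedP[g gC gx]].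
- by rewrite in_fsetU => /orP[] gC gx; [left|right]; apply/satisfiedP; exists g.
- by exists g => //; rewrite in_fsetU gC.
- by exists g => //; rewrite in_fsetU gC orbT.
Qed.

(** With all of [s] required, a point is lost exactly at the first clause of a derivation that it
    does not satisfy. *)
Definition loss (s : seq (clause rat)) (D : clause rat) : {set cube} :=
  [set x | all (satisfied^~ x) s && ~~ satisfied D x].

(** The second conclusion is needed because the empty clause has size 0 and cannot pay for lost
    points. It holds because a resolvent is never empty and the other rules lose nothing. *)
Lemma card_loss (s : seq (clause rat)) (D : clause rat) :
  (3 ^ n < (2 ^ n.-1) ^ 2)%N ->
  inference ([set [fset binary_form n]]%classic : set (clause rat)) s D ->
  (#|loss s D| ^ 2 <= 3 ^ n)%N /\ (D = fset0 -> loss s D = finset.set0).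
Proof.
move=> big_n inf_D.
have n_gt0 : (0 < n)%N by case: (n) big_n.
have loss0 : (forall x, all (satisfied^~ x) s -> satisfied D x) ->
    (#|loss s D| ^ 2 <= 3 ^ n)%N /\ (D = fset0 -> loss s D = finset.set0).
  move=> sat; suff -> : loss s D = finset.set0 by rewrite cards0.
  apply/setP => x; rewrite !inE; apply/negbTE/negP => /andP[/sat ->] //.
case: inf_D loss0 => {D} [C ->|i|C D f g a b fC gD|C a a0 aC|C f Cs] loss0.
- apply: loss0 => x _; apply/satisfiedP; exists (binary_form n).
    by rewrite in_fset1.
  exact: rich_binary_form.
- apply: loss0 => x _; apply/satisfiedP.
  case/orP: (rich_boolean i x big_n) => rx; eexists; try exact: rx.
    exact: fset21.
  exact: fset22.
- split=> [|/fsetP/(_ (a *: f + b *: g))]; last by rewrite fset1U1 in_fset0.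
  apply: leq_trans (card_resolution_loss a b f g); rewrite leq_exp2r //.
  apply/subset_leq_card/fintype.subsetP => x; rewrite !inE !satisfiedU1 satisfiedU.
  rewrite !negb_or => /andP[/allP sat /and3P[-> nC nD]].
  have := sat _ fC; have := sat _ gD.
  by rewrite !satisfiedU1 (negbTE nC) (negbTE nD) !orbF => -> ->.
- apply: loss0 => x /allP /(_ _ aC).
  by rewrite satisfiedU1 (negbTE (lconst_not_rich x a0)).
- by apply: loss0 => x /allP /(_ _ Cs) Cx; rewrite satisfiedU1 Cx orbT.
Qed.

End Levels.

(** * Counting the clauses of a refutation *)

Lemma clause_size_gt0 (C : clause rat) : C != fset0 -> (0 < clause_size C)%N.
Proof.
case/fset0Pn => f fC; rewrite /clause_size (big_fsetD1 f) //=.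
by rewrite /coef_bits /rat_bits /nat_bits !addnS.
Qed.

Lemma refutation_bound (n : nat) (p : seq (clause rat)) :
  (3 ^ n < (2 ^ n.-1) ^ 2)%N ->
  refutation ([set [fset binary_form n]]%classic : set (clause rat)) p ->
  exists2 t, (t ^ 2 <= 3 ^ n)%N & (2 ^ n <= derivation_size p * t)%N.
Proof.
move=> big_n [[s p_last] inf_p].
pose bad (i : 'I_(size p)) := loss n (take i p) (nth fset0 p i).
have bad_small (i : 'I_(size p)) := card_loss big_n (inf_p i (ltn_ord i)).
exists (\max_i #|bad i|).
  elim/big_ind: _ => [//|t u|i _]; last by case: (bad_small i).
  by rewrite /maxn; case: ifP.
(* The final empty clause fails everywhere, so each point has a first failing clause. *)
have cover : [set: {ffun 'I_n -> bool}]%SET \subset \bigcup_i bad i.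
  apply/fintype.subsetP => x _.
  have unsat : has (fun C => ~~ satisfied C x) p.
    by rewrite p_last has_rcons.
  have lt := unsat; rewrite has_find in lt.
  apply/bigcupP; exists (Ordinal lt); rewrite // inE /=.
  apply/andP; split; last exact: (nth_find fset0 unsat).
  apply/(all_nthP fset0) => j; rewrite size_take lt => ltj.
  by rewrite nth_take //; apply/negPn; rewrite (before_find fset0 ltj).
have /(leq_trans (subset_leq_card cover)) : (#|\bigcup_i bad i| <=
    \sum_i #|bad i|)%N.
  elim/big_rec2: _ => [|i t A _ le]; first by rewrite cards0.
  by rewrite (leq_trans (leq_card_setU _ _)) // leq_add2l.
rewrite cardsT card_ffun card_bool card_ord => /leq_trans; apply.
rewrite /derivation_size (big_nth fset0) big_mkord big_distrl /=.
apply: leq_sum => i _; have [_ empty] := bad_small i.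
have [/empty e|/clause_size_gt0 gt0] := eqVneq (nth fset0 p i) fset0.
  by rewrite /bad e cards0.
by rewrite (leq_trans (leq_bigmax (F := fun i => #|bad i|) i)) // leq_pmull.
Qed.

(** For n = 5 this is 243 < 256; each further step multiplies the left side by 3 and the right side
    by 4. *)
Lemma exp3_lt (n : nat) : (5 <= n)%N -> (3 ^ n < (2 ^ n.-1) ^ 2)%N.
Proof.
move=> /subnK <-; elim: (n - 5)%N => [//|m IHm].
rewrite addSn expnS (leq_trans (n := 4 * 3 ^ (m + 5))) //.
  by rewrite ltn_pmul2r ?expn_gt0.
have -> : (m + 5).+1.-1 = (m + 5).-1.+1 by rewrite prednK // addnS.
rewrite (expnS 2) expnMn.
by rewrite leq_pmul2l // ltnW.
Qed.

Theorem mainTheorem1 (R : realType) :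
  exists (c : R) (n0 : nat), 0 < c /\
    forall n : nat, (n0 <= n)%N ->
      forall p : seq (clause rat),
        refutation ([set [fset binary_form n]]%classic : set (clause rat)) p ->
        2 `^ (c * n%:R) <= (derivation_size p)%:R.
Proof.
exists 6^-1, 5%N; split=> [|n n_ge5 p ref_p]; first by rewrite invr_gt0.
have [t t_le s_ge] := refutation_bound (exp3_lt n_ge5) ref_p.
set s := derivation_size p in s_ge *.
(* The exponent 6 works because t^6 <= 27^n and 2 * 27 = 54 <= 64 = 2^6. *)
have le_s6 : (2 ^ n <= s ^ 6)%N.
  rewrite -(leq_pmul2r (m := 27 ^ n)) ?expn_gt0 //.
  apply: (@leq_trans ((2 ^ n) ^ 6)).
    rewrite -expnMn -(expnM 2) (mulnC n) expnM.
    by rewrite leq_exp2r // (leq_trans _ n_ge5).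
  apply: (@leq_trans ((s * t) ^ 6)); first by rewrite leq_exp2r.
  rewrite expnMn leq_mul2l -[27%N]/(3 ^ 3)%N -expnM mulnC expnM.
  by rewrite [(t ^ 6)%N](expnM t 2 3) leq_exp2r // t_le orbT.
rewrite -(ler_pXn2r (n := 6)) ?nnegrE ?powR_ge0 ?ler0n //.
rewrite -powR_mulrn ?powR_ge0 // -powRrM mulrAC mulVf ?pnatr_eq0 // mul1r.
by rewrite powR_mulrn // -!natrX ler_nat.
Qed.
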